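(* Let $G$ be a connected graph and let $H$ be an idomatic graph. Then $d_i(G\odot H)=d_i(H)+1$ if and only if $G$ has a partition (of its vertex set) into $d_i(H)+1$ independent sets.
   Context: All graphs are finite, undirected, without loops or multiple edges. For graphs $G$ and $H$, where $G$ has vertices $v_1,\dots,v_{n}$, the corona graph $G\odot H$ is obtained from one copy of $G$ and $n$ copies of $H$ by joining by an edge each vertex of the $i$-th copy of $H$ with the vertex $v_i$ of $G$. A set of vertices is independent if no two of its vertices are adjacent, and dominating if every vertex outside it has a neighbor in it. An idomatic partition of a graph is a partition of its vertex set into sets each of which is both independent and dominating. A graph is idomatic if it has an idomatic partition; the idomatic number $d_i(G)$ is the maximum number of sets in an idomatic partition of $G$. *)

(* Defs.v *)
From mathcomp Require Import all_boot.

Set Implicit Arguments.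
Unset Strict Implicit.
Unset Printing Implicit Defensive.

Record sgraph := SGraph {
  vertex :> finType;
  adj : rel vertex;
  adj_sym : symmetric adj;
  adj_irrefl : irreflexive adj
}.

(* The graph without vertices is not connected. *)
Definition connected (G : sgraph) : Prop :=
  0 < #|G| /\ forall x y : G, connect (@adj G) x y.

Section Corona.
Variables G H : sgraph.

(* [inl v] is the vertex [v] of [G]; [inr (v, w)] is the vertex [w] of the copy
   of [H] attached to [v]. *)
Definition corona_adj : rel (G + G * H)%type := fun a b =>
  match a, b with
  | inl u, inl v => adj u v
  | inl u, inr (v, _) => u == v
  | inr (u, _), inl v => u == v
  | inr (u, x), inr (v, y) => (u == v) && adj x y
  end.

Lemma corona_adj_sym : symmetric corona_adj.
Proof.
move=> [u|[u x]] [v|[v y]] /=; by [exact: adj_sym | rewrite eq_sym ?(adj_sym x)].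
Qed.

Lemma corona_adj_irrefl : irreflexive corona_adj.
Proof. by move=> [u|[u x]] /=; rewrite adj_irrefl ?andbF. Qed.

Definition corona : sgraph := SGraph corona_adj_sym corona_adj_irrefl.

End Corona.

Section Idomatic.
Variable G : sgraph.

Definition independent (S : {set G}) : bool :=
  [forall x in S, forall y in S, ~~ adj x y].

Definition dominating (S : {set G}) : bool :=
  [forall x, (x \notin S) ==> [exists y in S, adj x y]].

Definition idomatic_partition (P : {set {set G}}) : bool :=
  partition P [set: G] && [forall S in P, independent S && dominating S].

Definition idomatic : Prop := exists P : {set {set G}}, idomatic_partition P.

(* Equal to 0 when [G] is not idomatic, so [idomatic_number = k.+1] entails
   that [G] is idomatic. *)
Definition idomatic_number : nat :=
  \max_(P : {set {set G}} | idomatic_partition P) #|P|.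

(* As usual for colour classes, some of the [k] sets may be empty: with [K1] for
   both graphs, the corona is [K2], of idomatic number 2, but [K1] is not the
   union of two disjoint nonempty sets. *)
Definition has_independent_partition (k : nat) : Prop :=
  exists A : 'I_k -> {set G},
    [/\ \bigcup_(i < k) A i = [set: G],
        forall i j : 'I_k, i != j -> [disjoint A i & A j]
      & forall i : 'I_k, independent (A i)].

End Idomatic.

(* Main.v *)
Require Import Defs.
From mathcomp Require Import all_boot.

(** Idomatic partitions are handled as surjective proper colourings in which
    every vertex sees all the colours but its own. Given an idomatic colouring
    of [corona G H] and a vertex [v] of [G], the copy of [H] at [v] avoids the
    colour of [v] and is idomatically coloured by the remaining ones, so the
    corona has at most one colour more than [H] when [H] has a vertex.
    Conversely, a proper colouring of [G] by one colour more than an idomatic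
    colouring of [H] extends to the corona, by colouring the copy of [H] at [v]
    with the colours distinct from that of [v]. When [H] has no vertex, one
    independent set covering the connected graph [G] forces [G] to be a point. *)

Set Implicit Arguments.
Unset Strict Implicit.
Unset Printing Implicit Defensive.

Lemma independentP (G : sgraph) (S : {set G}) :
  reflect {in S &, forall x y, ~~ adj x y} (independent S).
Proof.
apply: (iffP forall_inP) => [indS x y Sx Sy|indS x Sx].
  by have /forall_inP := indS x Sx; apply.
by apply/forall_inP=> y; apply: indS.
Qed.

Lemma dominatingP (G : sgraph) (S : {set G}) :
  reflect (forall x, x \notin S -> exists2 y, y \in S & adj x y) (dominating S).
Proof.
apply: (iffP forall_inP) => domS x nSx; last exact/exists_inP/domS.
by apply/exists_inP/domS.
Qed.

Definition proper_coloring (G : sgraph) (I : Type) (f : G -> I) : Prop :=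
  forall x y, adj x y -> f x <> f y.

(** The clauses make the colour classes independent, dominating and nonempty. On a graph without
    vertices the last one forces [I] to be empty. *)
Definition idomatic_coloring (G : sgraph) (I : Type) (f : G -> I) : Prop :=
  [/\ proper_coloring f,
      forall x c, c <> f x -> exists2 y, adj x y & f y = c
    & forall c, exists x, f x = c].

Lemma has_independent_partitionP (G : sgraph) (k : nat) :
  has_independent_partition G k <->
  exists f : G -> 'I_k, proper_coloring f.
Proof.
split=> [[A [covA _ indA]]|[f fP]].
  have ex_class x : exists i, x \in A i.
    have : x \in \bigcup_(i < k) A i by rewrite covA inE.
    by case/bigcupP=> i _ Ai; exists i.
  exists (fun x => xchoose (ex_class x)) => x y xy eq_xy.
  have := xchooseP (ex_class x); rewrite eq_xy => Ax.
  by have /independentP/(_ _ _ Ax (xchooseP (ex_class y)))/negP :=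
    indA (xchoose (ex_class y)).
exists (fun i => [set x | f x == i]); split.
- by apply/setP=> x; rewrite inE; apply/bigcupP; exists (f x); rewrite ?inE.
- move=> i j neq_ij; apply/pred0P=> x /=; rewrite !inE.
  by apply: contraNF neq_ij => /andP[/eqP<- /eqP<-].
- move=> i; apply/independentP=> x y; rewrite !inE => /eqP fx /eqP fy.
  by apply/negP=> /fP; rewrite fx fy.
Qed.

(** The fibres of [f] form an idomatic partition; since they are nonempty, distinct colours have
    distinct fibres, so there are [#|I|] blocks. *)
Lemma idomatic_coloring_leq (G : sgraph) (I : finType) (f : G -> I) :
  idomatic_coloring f -> #|I| <= idomatic_number G.
Proof.
case=> fP fD fS; pose F (c : I) := [set x | f x == c].
have F_inj : injective F.
  move=> c d; have [x <-] := fS c => /setP/(_ x).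
  by rewrite !inE eqxx => /esym/eqP.
have <- : #|[set F c | c : I]| = #|I| by rewrite card_imset.
apply: leq_bigmax_cond; apply/andP; split.
  apply/and3P; split.
  - apply/eqP/setP=> x; rewrite inE; apply/bigcupP.
    by exists (F (f x)); rewrite ?imset_f // inE.
  - apply/trivIsetP=> _ _ /imsetP[c _ ->] /imsetP[d _ ->] neq.
    apply/pred0P=> x /=; rewrite !inE.
    by apply: contraNF neq => /andP[/eqP<- /eqP<-].
  - apply/imsetP=> -[c _ /setP F0]; have [x fx] := fS c.
    by have := F0 x; rewrite !inE fx eqxx.
apply/forall_inP=> _ /imsetP[c _ ->]; apply/andP; split.
  apply/independentP=> x y; rewrite !inE => /eqP fx /eqP fy.
  by apply/negP=> /fP; rewrite fx fy.
apply/dominatingP=> x; rewrite inE => /eqP fx.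
by have [|y xy fy] := fD x c; [move/esym | exists y; rewrite ?inE ?fy].
Qed.

Lemma idomatic_partition_coloring (G : sgraph) (P : {set {set G}}) :
  idomatic_partition P -> exists f : G -> 'I_#|P|, idomatic_coloring f.
Proof.
case/andP=> partP /forall_inP classP.
have [/eqP covP trivP nP0] := and3P partP.
have in_cov x : x \in cover P by rewrite covP inE.
have blockP x : pblock P x \in P by rewrite pblock_mem.
(* The colour of a vertex is the rank of its block in the enumeration of [P]; this turns equations
   between colours into membership in blocks. *)
have blockE x i :
    (enum_rank_in (blockP x) (pblock P x) == i) = (x \in enum_val i).
  have Pi := enum_valP i.
  apply/eqP/idP=> [<-|xi]; first by rewrite enum_rankK_in // mem_pblock.
  by apply: enum_val_inj; rewrite enum_rankK_in ?(def_pblock trivP Pi xi).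
exists (fun x => enum_rank_in (blockP x) (pblock P x)); split.
- move=> x y xy /eqP; set j := enum_rank_in _ (pblock P y).
  have yj : y \in enum_val j by rewrite -blockE.
  rewrite blockE => xj.
  have /andP[/independentP/(_ x y xj yj)] := classP _ (enum_valP j).
  by rewrite xy.
- move=> x c /nesym/eqP; rewrite blockE => xc.
  have /andP[_ /dominatingP/(_ x xc)[y yc xy]] := classP _ (enum_valP c).
  by exists y => //; apply/eqP; rewrite blockE.
- move=> c; have [c0|[x xc]] := set_0Vmem (enum_val c).
    by have := enum_valP c; rewrite c0 (negPf nP0).
  by exists x; apply/eqP; rewrite blockE.
Qed.

(** Idomaticity makes the maximum range over a nonempty family, so some partition attains it. *)
Lemma idomatic_number_coloring (G : sgraph) :
  idomatic G -> exists f : G -> 'I_(idomatic_number G), idomatic_coloring f.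
Proof.
case=> P0 P0P.
have [|P PP eqP] := @eq_bigmax_cond _ (@idomatic_partition G) (fun P => #|P|).
  by apply/card_gt0P; exists P0.
rewrite /idomatic_number eqP; exact: idomatic_partition_coloring.
Qed.

Lemma idomatic_number_gt0 (G : sgraph) : 0 < idomatic_number G -> idomatic G.
Proof.
move=> n_gt0; have [/existsP//|/existsPn nP] :=
  boolP [exists P : {set {set G}}, idomatic_partition P].
by move: n_gt0; rewrite /idomatic_number big_pred0 // => P; apply/negbTE.
Qed.

(** [lift (a v)] is a bijection from ['I_n] onto the colours other than [a v]. A vertex [v] of [G]
    sees these in its copy of [H] because [b] is surjective; a vertex of that copy sees [a v] at [v]
    and the others inside the copy. *)
Lemma corona_coloring (G H : sgraph) (n : nat)
    (a : G -> 'I_n.+1) (b : H -> 'I_n) :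
  0 < #|G| -> proper_coloring a -> idomatic_coloring b ->
  idomatic_coloring (fun z : corona G H =>
    match z with inl v => a v | inr (v, w) => lift (a v) (b w) end).
Proof.
case/card_gt0P=> v0 _ aP [bP bD bS].
split.
- move=> [u|[u x]] [v|[v y]] /=.
  + exact: aP.
  + by move/eqP<- => /eqP; rewrite (negPf (neq_lift _ _)).
  + by move/eqP<- => /esym/eqP; rewrite (negPf (neq_lift _ _)).
  + by case/andP=> /eqP<- xy /lift_inj; apply: bP.
- move=> [v|[v x]] c.
    case: (unliftP (a v) c) => [m ->|-> //] _; have [w <-] := bS m.
    by exists (inr (v, w)) => /=.
  case: (unliftP (a v) c) => [m ->|-> _]; last by exists (inl v) => /=.
  move=> neq.
  have [|y xy <-] := bD x m; first by move=> mE; apply: neq; rewrite mE.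
  by exists (inr (v, y)) => //=; rewrite eqxx.
- move=> c; case: (unliftP (a v0) c) => [m ->|->]; last by exists (inl v0).
  by have [w <-] := bS m; exists (inr (v0, w)).
Qed.

Lemma corona_idomatic_number_leq (G H : sgraph) :
  0 < #|G| -> 0 < #|H| -> idomatic (corona G H) ->
  idomatic_number (corona G H) <= (idomatic_number H).+1.
Proof.
case/card_gt0P=> v _ /card_gt0P[w0 _] /idomatic_number_coloring.
set n := idomatic_number _; case=> f [fP fD _].
pose c0 := f (inl v).
have f_copy w : f (inr (v, w)) != c0 by apply/eqP/fP => /=.
pose g w : {c | c != c0} := exist _ (f (inr (v, w))) (f_copy w).
have gD x c : c <> g x -> exists2 y, adj x y & g y = c.
  move=> neq; have [|z] := fD (inr (v, x)) (val c).
    by move=> cE; apply: neq; apply: val_inj.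
  (* The neighbour of colour [c] cannot be [v], whose colour is [c0], so it lies in the same
     copy. *)
  case: z => [u|[u y]] /= => [/eqP<- fz|/andP[/eqP<- xy] fz].
    by have := valP c; rewrite /= -fz eqxx.
  by exists y => //; apply: val_inj.
have /idomatic_coloring_leq : idomatic_coloring g.
  split=> // [x y xy [gE]|c]; first by apply: fP gE; rewrite /= eqxx.
  (* Every colour is that of [w0] or is seen by [w0]. *)
  have [->|/eqP/gD[y _ gy]] := eqVneq c (g w0); first by exists w0.
  by exists y.
(* There are [n.-1] colours besides [c0]; the case split on [n] removes the truncated
   predecessor. *)
by rewrite card_sig cardC1 card_ord -ltnS; case: (n).
Qed.

Lemma connected_edgeless (G : sgraph) :
  connected G -> (forall x y : G, ~~ adj x y) -> #|G| = 1.
Proof.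
case=> G_gt0 conG no_edge; apply/eqP; rewrite eqn_leq G_gt0 andbT.
apply/card_le1_eqP=> x y _ _.
have /connectP[[|z p] /=] := conG y x; first by [].
by rewrite (negPf (no_edge y z)).
Qed.

Lemma idomatic_number_leq_card (G : sgraph) :
  idomatic G -> idomatic_number G <= #|G|.
Proof.
case/idomatic_number_coloring=> f [_ _ fS].
have f_onto c : c \in codom f by have [x <-] := fS c; apply: codom_f.
rewrite -[X in X <= _]card_ord -(eq_card f_onto).
exact: leq_image_card.
Qed.

Theorem theorem19 (G H : sgraph) (hG : connected G) (hH : idomatic H) :
  idomatic_number (corona G H) = (idomatic_number H + 1)%N <->
  has_independent_partition G (idomatic_number H + 1).
Proof.
rewrite addn1; apply: (iff_trans _ (iff_sym (has_independent_partitionP _ _))).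
split=> [nE|[a aP]].
  have := @idomatic_number_coloring (corona G H).
  rewrite nE => -[|f [fP _ _]]; first by apply: idomatic_number_gt0; rewrite nE.
  by exists (fun v => f (inl v)) => u v uv; exact: (fP (inl u) (inl v)).
have [b bP] := idomatic_number_coloring hH.
have := idomatic_coloring_leq (corona_coloring hG.1 aP bP).
rewrite card_ord => n_ge; apply/eqP; rewrite eqn_leq n_ge andbT.
(* The lower bound is positive, so the corona is idomatic, as the upper bounds require. *)
have idC := idomatic_number_gt0 (leq_trans (ltn0Sn _) n_ge).
have [H0|H_gt0] := posnP #|H|; last exact: corona_idomatic_number_leq hG.1 _ _.
have n0 : idomatic_number H = 0.
  case: bP => _ _ bS; apply/eqP; rewrite -leqn0 leqNgt; apply/negP=> n_gt0.
  by have [w _] := bS (Ordinal n_gt0); have := card0_eq H0 w.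
(* With [n0], [a] uses a single colour, so [G] has no edge; the corona is then a single vertex. *)
have G1 : #|G| = 1.
  apply: (connected_edgeless hG) => x y; apply/negP=> /aP; apply.
  by move: (a x) (a y); rewrite n0 => i j; rewrite !ord1.
have := idomatic_number_leq_card idC.
by rewrite card_sum card_prod H0 G1 n0.
Qed.
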